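(* Let $\mathcal{Q}$ be a small quantaloid and let $(F,G):\phi\to\psi$ be an infomorphism between $\mathcal{Q}$-distributors $\phi:\mathbb{A}\rightsquigarrow\mathbb{B}$ and $\psi:\mathbb{A}'\rightsquigarrow\mathbb{B}'$. Then $F:(\mathbb{A},\phi^{\downarrow}\circ\phi_{\uparrow})\to(\mathbb{A}',\psi^{\downarrow}\circ\psi_{\uparrow})$ is a continuous $\mathcal{Q}$-functor between $\mathcal{Q}$-closure spaces.
   Context: A quantaloid $\mathcal{Q}$ is a category whose hom-sets are complete lattices and whose composition preserves arbitrary joins in each variable; it is small if its objects $\mathcal{Q}_0$ and arrows form sets. For $f:X\to Y$, $g:Y\to Z$, $h:X\to Z$ in a quantaloid, $h\swarrow f:Y\to Z$ is the largest arrow with $(h\swarrow f)\circ f\le h$, and $g\searrow h:X\to Y$ is the largest arrow with $g\circ(g\searrow h)\le h$. A $\mathcal{Q}$-category $\mathbb{A}$ is a set $\mathbb{A}_0$ with a type map $t:\mathbb{A}_0\to\mathcal{Q}_0$ and hom-arrows $\mathbb{A}(x,y)\in\mathcal{Q}(tx,ty)$ with $1_{tx}\le\mathbb{A}(x,x)$ and $\mathbb{A}(y,z)\circ\mathbb{A}(x,y)\le\mathbb{A}(x,z)$. A $\mathcal{Q}$-functor $F:\mathbb{A}\to\mathbb{B}$ is a type-preserving map with $\mathbb{A}(x,x')\le\mathbb{B}(Fx,Fx')$. The underlying preorder on $\mathbb{A}_0$ is: $x\le y$ iff $tx=ty$ and $1_{tx}\le\mathbb{A}(x,y)$; $\mathcal{Q}$-functors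 are ordered pointwise. A $\mathcal{Q}$-distributor $\phi:\mathbb{A}\rightsquigarrow\mathbb{B}$ assigns to each $(x,y)\in\mathbb{A}_0\times\mathbb{B}_0$ an arrow $\phi(x,y)\in\mathcal{Q}(tx,ty)$ with $\mathbb{B}(y',y)\circ\phi(x,y')\le\phi(x,y)$ and $\phi(x',y)\circ\mathbb{A}(x,x')\le\phi(x,y)$. $\mathcal{Q}$-categories and $\mathcal{Q}$-distributors form a quantaloid with pointwise order, composition $(\psi\circ\phi)(x,z)=\bigvee_y\psi(y,z)\circ\phi(x,y)$, identities given by hom-arrows, and implications $(\eta\swarrow\phi)(y,z)=\bigwedge_x\eta(x,z)\swarrow\phi(x,y)$, $(\psi\searrow\eta)(x,y)=\bigwedge_z\psi(y,z)\searrow\eta(x,z)$. For $X\in\mathcal{Q}_0$, $*_X$ is the $\mathcal{Q}$-category with one object of type $X$ and hom-arrow $1_X$. $\mathcal{P}\mathbb{A}$ has as objects of type $X$ the distributors $\mu:\mathbb{A}\rightsquigarrow *_X$, with $\mathcal{P}\mathbb{A}(\mu,\lambda)=\lambda\swarrow\mu$. $\mathcal{P}^{\dagger}\mathbb{A}$ has as objects of type $X$ the distributors $\mu:*_X\rightsquigarrow\mathbb{A}$, with $\mathcal{P}^{\dagger}\mathbb{A}(\mu,\lambda)=\lambda\searrow\mu$. For $\phi:\mathbb{A}\rightsquigarrow\mathbb{B}$, the $\mathcal{Q}$-functors $\phi_{\uparrow}:\mathcal{P}\mathbb{A}\to\mathcal{P}^{\dagger}\mathbb{B}$, $\phi_{\uparrow}(\mu)=\phi\swarrow\mu$,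 and $\phi^{\downarrow}:\mathcal{P}^{\dagger}\mathbb{B}\to\mathcal{P}\mathbb{A}$, $\phi^{\downarrow}(\lambda)=\lambda\searrow\phi$, satisfy $\phi_{\uparrow}\dashv\phi^{\downarrow}$. An infomorphism $(F,G):\phi\to\psi$ from $\phi:\mathbb{A}\rightsquigarrow\mathbb{B}$ to $\psi:\mathbb{A}'\rightsquigarrow\mathbb{B}'$ is a pair of $\mathcal{Q}$-functors $F:\mathbb{A}\to\mathbb{A}'$, $G:\mathbb{B}'\to\mathbb{B}$ with $\phi(x,Gy')=\psi(Fx,y')$ for all $x\in\mathbb{A}_0$, $y'\in\mathbb{B}'_0$. A $\mathcal{Q}$-closure space is a pair $(\mathbb{A},C)$ of a $\mathcal{Q}$-category $\mathbb{A}$ and a $\mathcal{Q}$-functor $C:\mathcal{P}\mathbb{A}\to\mathcal{P}\mathbb{A}$ with $1\le C$ and $C\circ C=C$; for example $(\mathbb{A},\phi^{\downarrow}\circ\phi_{\uparrow})$. A continuous $\mathcal{Q}$-functor $F:(\mathbb{A},C)\to(\mathbb{B},D)$ is a $\mathcal{Q}$-functor $F:\mathbb{A}\to\mathbb{B}$ with $F^{\rightarrow}\circ C\le D\circ F^{\rightarrow}$, where $F^{\rightarrow}:\mathcal{P}\mathbb{A}\to\mathcal{P}\mathbb{B}$ is $F^{\rightarrow}(\mu)=\mu\circ F^{\natural}$ and $F^{\natural}:\mathbb{B}\rightsquigarrow\mathbb{A}$ is $F^{\natural}(y,x)=\mathbb{B}(y,Fx)$. *)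

(* Defs.v *)
From mathcomp Require Import ssreflect ssrfun ssrbool.
From mathcomp Require Import boolp classical_sets.

Set Implicit Arguments.
Unset Strict Implicit.
Unset Printing Implicit Defensive.

Local Open Scope classical_set_scope.

Declare Scope quantaloid_scope.
Delimit Scope quantaloid_scope with Q.
Local Open Scope quantaloid_scope.

(* The complete-lattice structure of a hom-set is given by its partial order
   and its arbitrary joins; meets are derived in [qinf] below.  Arrows are
   composed in the order [qcomp g f] = "g after f". *)
Record quantaloid := Quantaloid {
  Ob :> Type;
  Hom : Ob -> Ob -> Type;
  qle : forall X Y, Hom X Y -> Hom X Y -> Prop;
  qle_refl : forall X Y (f : Hom X Y), qle f f;
  qle_trans : forall X Y (f g h : Hom X Y), qle f g -> qle g h -> qle f h;
  qle_anti : forall X Y (f g : Hom X Y), qle f g -> qle g f -> f = g;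
  qsup : forall X Y, set (Hom X Y) -> Hom X Y;
  qsup_ub : forall X Y (S : set (Hom X Y)) f, S f -> qle f (qsup S);
  qsup_least : forall X Y (S : set (Hom X Y)) g,
    (forall f, S f -> qle f g) -> qle (qsup S) g;
  idm : forall X, Hom X X;
  qcomp : forall X Y Z, Hom Y Z -> Hom X Y -> Hom X Z;
  qcomp1m : forall X Y (f : Hom X Y), qcomp (idm Y) f = f;
  qcompm1 : forall X Y (f : Hom X Y), qcomp f (idm X) = f;
  qcompA : forall X Y Z W (h : Hom Z W) (g : Hom Y Z) (f : Hom X Y),
    qcomp h (qcomp g f) = qcomp (qcomp h g) f;
  qcomp_supr : forall X Y Z (g : Hom Y Z) (S : set (Hom X Y)),
    qcomp g (qsup S) = qsup [set qcomp g f | f in S];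
  qcomp_supl : forall X Y Z (S : set (Hom Y Z)) (f : Hom X Y),
    qcomp (qsup S) f = qsup [set qcomp g f | g in S]
}.

Arguments idm {q} X.

Notation "f ⊑ g" := (qle f g) (at level 70, no associativity) : quantaloid_scope.
Notation "g ∘ f" := (qcomp g f) (at level 40, left associativity)
  : quantaloid_scope.

Section Arrows.
Variable Q : quantaloid.
Implicit Types X Y Z : Q.

Definition qinf X Y (S : set (Hom X Y)) : Hom X Y :=
  qsup [set k | forall f, S f -> k ⊑ f].

(* The largest arrow [k] with [k ∘ f ⊑ h]; see [qle_limpl]. *)
Definition limpl X Y Z (h : Hom X Z) (f : Hom X Y) : Hom Y Z :=
  qsup [set k | k ∘ f ⊑ h].

(* The largest arrow [k] with [g ∘ k ⊑ h]; see [qle_rimpl]. *)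
Definition rimpl X Y Z (g : Hom Y Z) (h : Hom X Z) : Hom X Y :=
  qsup [set k | g ∘ k ⊑ h].

Lemma qle_inf X Y (S : set (Hom X Y)) k :
  k ⊑ qinf S <-> forall f, S f -> k ⊑ f.
Proof.
split=> [kS f Sf|kS]; last exact: qsup_ub.
by apply: qle_trans kS _; apply: qsup_least => g /(_ f Sf).
Qed.

Lemma qcomp_monor X Y Z (g : Hom Y Z) (f f' : Hom X Y) :
  f ⊑ f' -> g ∘ f ⊑ g ∘ f'.
Proof.
move=> ff'; have -> : f' = qsup [set f; f'].
  apply: qle_anti; first by apply: qsup_ub; right.
  by apply: qsup_least => h [-> | ->] //; exact: qle_refl.
by rewrite qcomp_supr; apply: qsup_ub; exists f => //; left.
Qed.

Lemma qcomp_monol X Y Z (g g' : Hom Y Z) (f : Hom X Y) :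
  g ⊑ g' -> g ∘ f ⊑ g' ∘ f.
Proof.
move=> gg'; have -> : g' = qsup [set g; g'].
  apply: qle_anti; first by apply: qsup_ub; right.
  by apply: qsup_least => h [-> | ->] //; exact: qle_refl.
by rewrite qcomp_supl; apply: qsup_ub; exists g => //; left.
Qed.

Lemma qle_limpl X Y Z (h : Hom X Z) (f : Hom X Y) k :
  k ⊑ limpl h f <-> k ∘ f ⊑ h.
Proof.
split=> [kh|kh]; last exact: qsup_ub.
apply: qle_trans (qcomp_monol _ kh) _; rewrite qcomp_supl.
by apply: qsup_least => _ [g gh <-].
Qed.

Lemma qle_rimpl X Y Z (g : Hom Y Z) (h : Hom X Z) k :
  k ⊑ rimpl g h <-> g ∘ k ⊑ h.
Proof.
split=> [kh|kh]; last exact: qsup_ub.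
apply: qle_trans (qcomp_monor _ kh) _; rewrite qcomp_supr.
by apply: qsup_least => _ [f fh <-].
Qed.

End Arrows.

(* A set of objects with a type map to [Q] is presented by its fibres:
   [A X] is the set of objects of [A] of type [X].  Type-preserving maps are
   then families of maps between fibres, and no transport along equalities of
   types is needed. *)
Record qcat (Q : quantaloid) := QCat {
  qobj :> Q -> Type;
  qhom : forall X Y, qobj X -> qobj Y -> Hom X Y;
  qhom_id : forall X (x : qobj X), idm X ⊑ qhom x x;
  qhom_comp : forall X Y Z (x : qobj X) (y : qobj Y) (z : qobj Z),
    qhom y z ∘ qhom x y ⊑ qhom x z
}.

Record qfunctor (Q : quantaloid) (A B : qcat Q) := QFunctor {
  qfun : forall X, A X -> B X;
  qfun_hom : forall X Y (x : A X) (y : A Y),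
    qhom x y ⊑ qhom (qfun x) (qfun y)
}.
Arguments qfun {Q A B} q {X} _.

Record qdist (Q : quantaloid) (A B : qcat Q) := QDist {
  qdapp : forall X Y, A X -> B Y -> Hom X Y;
  qdist_cod : forall X Y Y' (x : A X) (y : B Y) (y' : B Y'),
    qhom y' y ∘ qdapp x y' ⊑ qdapp x y;
  qdist_dom : forall X X' Y (x : A X) (x' : A X') (y : B Y),
    qdapp x' y ∘ qhom x x' ⊑ qdapp x y
}.
Arguments qdapp {Q A B} q {X Y} _ _.

Section Functors.
Variable Q : quantaloid.

Definition obj_le (A : qcat Q) X (x y : A X) : Prop := idm X ⊑ qhom x y.

Definition qfun_le (A B : qcat Q) (F G : qfunctor A B) : Prop :=
  forall X (x : A X), obj_le (qfun F x) (qfun G x).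

Definition qfun_id (A : qcat Q) : qfunctor A A :=
  @QFunctor Q A A (fun _ x => x) (fun _ _ _ _ => qle_refl _).

Lemma qfun_comp_subproof (A B C : qcat Q) (G : qfunctor B C)
    (F : qfunctor A B) X Y (x : A X) (y : A Y) :
  qhom x y ⊑ qhom (qfun G (qfun F x)) (qfun G (qfun F y)).
Proof. exact: qle_trans (qfun_hom F x y) (qfun_hom G _ _). Qed.

Definition qfun_comp (A B C : qcat Q) (G : qfunctor B C) (F : qfunctor A B) :
    qfunctor A C :=
  QFunctor (qfun_comp_subproof G F).

End Functors.

Section Distributors.
Variable Q : quantaloid.
Implicit Types A B C : qcat Q.

Section Comp.
Variables (A B C : qcat Q) (psi : qdist B C) (phi : qdist A B).

Definition qdcomp_app X Z (x : A X) (z : C Z) : Hom X Z :=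
  qsup [set h | exists Y (y : B Y), h = qdapp psi y z ∘ qdapp phi x y].

Lemma qdcomp_cod X Z Z' (x : A X) (z : C Z) (z' : C Z') :
  qhom z' z ∘ qdcomp_app x z' ⊑ qdcomp_app x z.
Proof.
rewrite qcomp_supr; apply: qsup_least => _ [_ [Y [y ->]] <-].
rewrite qcompA; apply: qle_trans (qcomp_monol _ (qdist_cod psi y z z')) _.
by apply: qsup_ub; exists Y, y.
Qed.

Lemma qdcomp_dom X X' Z (x : A X) (x' : A X') (z : C Z) :
  qdcomp_app x' z ∘ qhom x x' ⊑ qdcomp_app x z.
Proof.
rewrite qcomp_supl; apply: qsup_least => _ [_ [Y [y ->]] <-].
rewrite -qcompA; apply: qle_trans (qcomp_monor _ (qdist_dom phi x x' y)) _.
by apply: qsup_ub; exists Y, y.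
Qed.

Definition qdcomp : qdist A C := QDist qdcomp_cod qdcomp_dom.

End Comp.

Section Limpl.
Variables (A B C : qcat Q) (eta : qdist A C) (phi : qdist A B).

Definition qdlimpl_app Y Z (y : B Y) (z : C Z) : Hom Y Z :=
  qinf [set h | exists X (x : A X), h = limpl (qdapp eta x z) (qdapp phi x y)].

Lemma qle_qdlimpl Y Z (y : B Y) (z : C Z) k :
  k ⊑ qdlimpl_app y z <->
  forall X (x : A X), k ∘ qdapp phi x y ⊑ qdapp eta x z.
Proof.
split=> [/qle_inf kS X x|kS]; first by apply/qle_limpl/kS; exists X, x.
by apply/qle_inf => _ [X [x ->]]; apply/qle_limpl.
Qed.

Lemma qdlimplP X Y Z (x : A X) (y : B Y) (z : C Z) :
  qdlimpl_app y z ∘ qdapp phi x y ⊑ qdapp eta x z.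
Proof. by move: X x; apply/qle_qdlimpl; exact: qle_refl. Qed.

Lemma qdlimpl_cod Y Z Z' (y : B Y) (z : C Z) (z' : C Z') :
  qhom z' z ∘ qdlimpl_app y z' ⊑ qdlimpl_app y z.
Proof.
apply/qle_qdlimpl => X x; rewrite -qcompA.
apply: qle_trans (qcomp_monor _ _) (qdist_cod eta x z z').
exact: qdlimplP.
Qed.

Lemma qdlimpl_dom Y Y' Z (y : B Y) (y' : B Y') (z : C Z) :
  qdlimpl_app y' z ∘ qhom y y' ⊑ qdlimpl_app y z.
Proof.
apply/qle_qdlimpl => X x; rewrite -qcompA.
apply: qle_trans (qcomp_monor _ (qdist_cod phi x y' y)) _.
exact: qdlimplP.
Qed.

Definition qdlimpl : qdist B C := QDist qdlimpl_cod qdlimpl_dom.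

End Limpl.

Section Rimpl.
Variables (A B C : qcat Q) (psi : qdist B C) (eta : qdist A C).

Definition qdrimpl_app X Y (x : A X) (y : B Y) : Hom X Y :=
  qinf [set h | exists Z (z : C Z), h = rimpl (qdapp psi y z) (qdapp eta x z)].

Lemma qle_qdrimpl X Y (x : A X) (y : B Y) k :
  k ⊑ qdrimpl_app x y <->
  forall Z (z : C Z), qdapp psi y z ∘ k ⊑ qdapp eta x z.
Proof.
split=> [/qle_inf kS Z z|kS]; first by apply/qle_rimpl/kS; exists Z, z.
by apply/qle_inf => _ [Z [z ->]]; apply/qle_rimpl.
Qed.

Lemma qdrimplP X Y Z (x : A X) (y : B Y) (z : C Z) :
  qdapp psi y z ∘ qdrimpl_app x y ⊑ qdapp eta x z.
Proof. by move: Z z; apply/qle_qdrimpl; exact: qle_refl. Qed.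

Lemma qdrimpl_cod X Y Y' (x : A X) (y : B Y) (y' : B Y') :
  qhom y' y ∘ qdrimpl_app x y' ⊑ qdrimpl_app x y.
Proof.
apply/qle_qdrimpl => Z z; rewrite qcompA.
apply: qle_trans (qcomp_monol _ (qdist_dom psi y' y z)) _.
exact: qdrimplP.
Qed.

Lemma qdrimpl_dom X X' Y (x : A X) (x' : A X') (y : B Y) :
  qdrimpl_app x' y ∘ qhom x x' ⊑ qdrimpl_app x y.
Proof.
apply/qle_qdrimpl => Z z; rewrite qcompA.
apply: qle_trans (qcomp_monol _ _) (qdist_dom eta x x' z).
exact: qdrimplP.
Qed.

Definition qdrimpl : qdist A B := QDist qdrimpl_cod qdrimpl_dom.

End Rimpl.
End Distributors.

Section Presheaves.
Variable Q : quantaloid.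

(* [*_X]: the fibre over [X] has exactly one object, all others are empty. *)
Variant star_obj (X : Q) : Q -> Type := Star : star_obj X X.

Definition star_hom (X Y Z : Q) (s : star_obj X Y) (t : star_obj X Z) :
    Hom Y Z :=
  match s in star_obj _ Y', t in star_obj _ Z' return Hom Y' Z' with
  | Star, Star => idm X
  end.

Lemma star_hom_id (X Y : Q) (s : star_obj X Y) : idm Y ⊑ star_hom s s.
Proof. by case: s; exact: qle_refl. Qed.

Lemma star_hom_comp (X Y Z W : Q) (s : star_obj X Y) (t : star_obj X Z)
    (u : star_obj X W) : star_hom t u ∘ star_hom s t ⊑ star_hom s u.
Proof. by case: s; case: t; case: u; rewrite /= qcomp1m; exact: qle_refl. Qed.

Definition star (X : Q) : qcat Q := QCat (@star_hom_id X) (@star_hom_comp X).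

Section PA.
Variable A : qcat Q.

(* Here and in [PdSh_hom], a distributor [*_X ⇝ *_Y] is identified with its
   only component, an arrow [X -> Y].  [PSh A] is the category of contravariant
   presheaves (P A), and [PdSh A] that of covariant ones (P^† A). *)
Definition PSh_hom X Y (mu : qdist A (star X)) (la : qdist A (star Y)) :
    Hom X Y :=
  qdapp (qdlimpl la mu) (Star X) (Star Y).

Lemma PSh_hom_id X (mu : qdist A (star X)) : idm X ⊑ PSh_hom mu mu.
Proof. by apply/qle_qdlimpl => Y x; rewrite qcomp1m; exact: qle_refl. Qed.

Lemma PSh_hom_comp X Y Z (mu : qdist A (star X)) (la : qdist A (star Y))
    (nu : qdist A (star Z)) : PSh_hom la nu ∘ PSh_hom mu la ⊑ PSh_hom mu nu.
Proof.
apply/qle_qdlimpl => W x; rewrite -qcompA.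
apply: (@qle_trans _ _ _ _ (PSh_hom la nu ∘ qdapp la x (Star Y))).
  by apply: qcomp_monor; exact: qdlimplP.
exact: qdlimplP.
Qed.

Definition PSh : qcat Q := QCat PSh_hom_id PSh_hom_comp.

Definition PdSh_hom X Y (mu : qdist (star X) A) (la : qdist (star Y) A) :
    Hom X Y :=
  qdapp (qdrimpl la mu) (Star X) (Star Y).

Lemma PdSh_hom_id X (mu : qdist (star X) A) : idm X ⊑ PdSh_hom mu mu.
Proof. by apply/qle_qdrimpl => Y x; rewrite qcompm1; exact: qle_refl. Qed.

Lemma PdSh_hom_comp X Y Z (mu : qdist (star X) A) (la : qdist (star Y) A)
    (nu : qdist (star Z) A) : PdSh_hom la nu ∘ PdSh_hom mu la ⊑ PdSh_hom mu nu.
Proof.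
apply/qle_qdrimpl => W x; rewrite qcompA.
apply: (@qle_trans _ _ _ _ (qdapp la (Star Y) x ∘ PdSh_hom mu la)).
  by apply: qcomp_monol; exact: qdrimplP.
exact: qdrimplP.
Qed.

Definition PdSh : qcat Q := QCat PdSh_hom_id PdSh_hom_comp.

End PA.

Section Isbell.
Variables (A B : qcat Q) (phi : qdist A B).

Lemma isbell_up_subproof X Y (mu : PSh A X) (la : PSh A Y) :
  qhom mu la ⊑ @qhom _ (PdSh B) _ _ (qdlimpl phi mu) (qdlimpl phi la).
Proof.
apply/qle_qdrimpl => Z b; apply/qle_qdlimpl => W x; rewrite -qcompA.
apply: (@qle_trans _ _ _ _ (qdapp (qdlimpl phi la) (Star Y) b
                           ∘ qdapp la x (Star Y))).
  by apply: qcomp_monor; exact: qdlimplP.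
exact: qdlimplP.
Qed.

Definition isbell_up : qfunctor (PSh A) (PdSh B) :=
  @QFunctor Q (PSh A) (PdSh B) (fun X mu => qdlimpl phi mu) isbell_up_subproof.

Lemma isbell_down_subproof X Y (mu : PdSh B X) (la : PdSh B Y) :
  qhom mu la ⊑ @qhom _ (PSh A) _ _ (qdrimpl mu phi) (qdrimpl la phi).
Proof.
apply/qle_qdlimpl => W x; apply/qle_qdrimpl => Z b; rewrite qcompA.
apply: (@qle_trans _ _ _ _ (qdapp mu (Star X) b
                           ∘ qdapp (qdrimpl mu phi) x (Star X))).
  by apply: qcomp_monol; exact: qdrimplP.
exact: qdrimplP.
Qed.

Definition isbell_down : qfunctor (PdSh B) (PSh A) :=
  @QFunctor Q (PdSh B) (PSh A) (fun X la => qdrimpl la phi)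
    isbell_down_subproof.

End Isbell.

Section DirectImage.
Variables (A B : qcat Q) (F : qfunctor A B).

Lemma cograph_cod X Y Y' (x : B X) (y : A Y) (y' : A Y') :
  qhom y' y ∘ qhom x (qfun F y') ⊑ qhom x (qfun F y).
Proof.
exact: qle_trans (qcomp_monol _ (qfun_hom F y' y)) (qhom_comp _ _ _).
Qed.

Lemma cograph_dom X X' Y (x : B X) (x' : B X') (y : A Y) :
  qhom x' (qfun F y) ∘ qhom x x' ⊑ qhom x (qfun F y).
Proof. exact: qhom_comp. Qed.

(* [F^♮ : B ⇝ A] *)
Definition cograph : qdist B A :=
  @QDist Q B A (fun _ _ y x => qhom y (qfun F x)) cograph_cod cograph_dom.

Lemma direct_image_subproof X Y (mu : PSh A X) (la : PSh A Y) :
  qhom mu la ⊑ @qhom _ (PSh B) _ _ (qdcomp mu cograph) (qdcomp la cograph).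
Proof.
apply/qle_qdlimpl => Z b; rewrite qcomp_supr.
apply: qsup_least => _ [_ [W [x ->]] <-]; rewrite qcompA.
apply: (@qle_trans _ _ _ _ (qdapp la x (Star Y) ∘ qdapp cograph b x)).
  by apply: qcomp_monol; exact: qdlimplP.
by apply: qsup_ub; exists W, x.
Qed.

Definition direct_image : qfunctor (PSh A) (PSh B) :=
  @QFunctor Q (PSh A) (PSh B) (fun X mu => qdcomp mu cograph)
    direct_image_subproof.

End DirectImage.
End Presheaves.

Section ClosureSpaces.
Variable Q : quantaloid.

Definition is_infomorphism (A B A' B' : qcat Q) (phi : qdist A B)
    (psi : qdist A' B') (F : qfunctor A A') (G : qfunctor B' B) : Prop :=
  forall X Y (x : A X) (y' : B' Y),
    qdapp phi x (qfun G y') = qdapp psi (qfun F x) y'.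

Definition is_closure_space (A : qcat Q) (C : qfunctor (PSh A) (PSh A)) :
    Prop :=
  qfun_le (qfun_id (PSh A)) C /\ qfun_comp C C = C.

Record closure_space := ClosureSpace {
  cs_cat : qcat Q;
  cs_op : qfunctor (PSh cs_cat) (PSh cs_cat);
  cs_closure : is_closure_space cs_op
}.

Definition is_continuous (S T : closure_space)
    (F : qfunctor (cs_cat S) (cs_cat T)) : Prop :=
  qfun_le (qfun_comp (direct_image F) (cs_op S))
          (qfun_comp (cs_op T) (direct_image F)).

Definition isbell_closure (A B : qcat Q) (phi : qdist A B) :
    qfunctor (PSh A) (PSh A) :=
  qfun_comp (isbell_down phi) (isbell_up phi).

End ClosureSpaces.

(* Main.v *)
(* The Isbell closure of [mu] is [(phi ↙ mu) ↘ phi], so the closure axioms are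
   those of the Galois connection between [phi ↙ -] and [- ↘ phi].  For
   continuity, the equation [phi(x, G y) = psi(F x, y)] shows that the component
   of [psi ↙ F^→ mu] at [y] lies below that of [phi ↙ mu] at [G y]; transposing
   along [↘] turns this into [F^→ (C mu) ⊑ D (F^→ mu)], where [C] and [D] are
   the closures of [phi] and [psi]. *)
From mathcomp Require Import ssreflect ssrfun ssrbool.
From mathcomp Require Import boolp.
Require Import Defs.

Set Implicit Arguments.
Unset Strict Implicit.
Unset Printing Implicit Defensive.

Local Open Scope quantaloid_scope.

Section Extensionality.
Variable Q : quantaloid.

(** The two distributor laws are propositions, so by proof irrelevance only the components
    matter. *)
Lemma qdist_eq (A B : qcat Q) (phi psi : qdist A B) :
  (forall X Y (x : A X) (y : B Y), qdapp phi x y = qdapp psi x y) -> phi = psi.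
Proof.
case: phi psi => [f fc fd] [g gc gd] /= fg.
have eq_fg : f = g.
  by apply: functional_extensionality_dep => X;
     apply: functional_extensionality_dep => Y;
     apply/funext => x; apply/funext => y.
by subst g; congr QDist; exact: Prop_irrelevance.
Qed.

Lemma qfunctor_eq (A B : qcat Q) (F G : qfunctor A B) :
  (forall X (x : A X), qfun F x = qfun G x) -> F = G.
Proof.
case: F G => [f fh] [g gh] /= fg.
have eq_fg : f = g.
  by apply: functional_extensionality_dep => X; apply/funext => x.
by subst g; congr QFunctor; exact: Prop_irrelevance.
Qed.

End Extensionality.

Section Galois.
Variables (Q : quantaloid) (A B C : qcat Q) (eta : qdist A C).

Lemma qle_qdrimpl_qdlimpl (phi : qdist A B) X Y (x : A X) (y : B Y) :
  qdapp phi x y ⊑ qdapp (qdrimpl (qdlimpl eta phi) eta) x y.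
Proof. by apply/qle_qdrimpl => Z z; exact: qdlimplP. Qed.

Lemma qle_qdlimpl_qdrimpl (psi : qdist B C) Y Z (y : B Y) (z : C Z) :
  qdapp psi y z ⊑ qdapp (qdlimpl eta (qdrimpl psi eta)) y z.
Proof. by apply/qle_qdlimpl => X x; exact: qdrimplP. Qed.

(** Triangle identity of the Galois connection: one inequality is its unit, the other holds because
    [eta ↙ -] is antitone. It yields idempotence of the Isbell closure. *)
Lemma qdlimpl_qdrimplK (phi : qdist A B) :
  qdlimpl eta (qdrimpl (qdlimpl eta phi) eta) = qdlimpl eta phi.
Proof.
apply: qdist_eq => Y Z y z; apply: qle_anti; last exact: qle_qdlimpl_qdrimpl.
apply/qle_qdlimpl => X x.
apply: qle_trans (qcomp_monor _ (qle_qdrimpl_qdlimpl phi x y)) _.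
exact: qdlimplP.
Qed.

End Galois.

Section Continuity.
Variable Q : quantaloid.

(** Transposing the identity arrow across [la ↙ mu] reduces the underlying order to the pointwise
    one. *)
Lemma obj_le_PSh (A : qcat Q) X (mu la : PSh A X) :
  (forall Y (x : A Y), qdapp mu x (Star X) ⊑ qdapp la x (Star X)) ->
  obj_le mu la.
Proof. by move=> mula; apply/qle_qdlimpl => Y x; rewrite qcomp1m. Qed.

Lemma isbell_closure_closure (A B : qcat Q) (phi : qdist A B) :
  is_closure_space (isbell_closure phi).
Proof.
split=> [X mu|].
  by apply: obj_le_PSh => Y x; exact: qle_qdrimpl_qdlimpl.
by apply: qfunctor_eq => X mu /=; rewrite qdlimpl_qdrimplK.
Qed.

Lemma qle_direct_image (A A' : qcat Q) (F : qfunctor A A') X (mu : PSh A X)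
    Y (x : A Y) :
  qdapp mu x (Star X) ⊑ qdapp (qfun (direct_image F) mu) (qfun F x) (Star X).
Proof.
rewrite -[X in X ⊑ _]qcompm1.
apply: qle_trans (qcomp_monor _ (qhom_id (qfun F x))) _.
(* [x] itself indexes a term of the join defining the direct image at [F x]. *)
by apply: qsup_ub; exists Y, x.
Qed.

Section Infomorphism.
Variables (A B A' B' : qcat Q) (phi : qdist A B) (psi : qdist A' B').
Variables (F : qfunctor A A') (G : qfunctor B' B).
Hypothesis FG : is_infomorphism phi psi F G.

Lemma isbell_up_direct_image X (mu : PSh A X) Y (y' : B' Y) :
  qdapp (qfun (isbell_up psi) (qfun (direct_image F) mu)) (Star X) y' ⊑
  qdapp (qfun (isbell_up phi) mu) (Star X) (qfun G y').
Proof.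
(* Only the objects [F x] of [A'] need to be tested against [psi]. *)
apply/qle_qdlimpl => Z x; rewrite FG.
apply: qle_trans (qcomp_monor _ (qle_direct_image F mu x)) _.
exact: qdlimplP.
Qed.

Lemma direct_image_isbell_closure :
  qfun_le (qfun_comp (direct_image F) (isbell_closure phi))
          (qfun_comp (isbell_closure psi) (direct_image F)).
Proof.
move=> X mu; apply: obj_le_PSh => Y x'.
apply: qsup_least => _ [Z [x ->]]; apply/qle_qdrimpl => W y'.
(* The cograph factor [A'(x', F x)] is absorbed by the action of [A'] on [psi], leaving a bound by
   [psi(F x, y')], which is [phi(x, G y')]. *)
rewrite qcompA; apply: qle_trans (qdist_dom psi x' (qfun F x) y').
apply: qcomp_monol; rewrite -FG.
apply: qle_trans (qcomp_monol _ (isbell_up_direct_image mu y')) _.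
exact: qdrimplP.
Qed.

End Infomorphism.
End Continuity.

Theorem proposition5p2p1 (Q : quantaloid) (A B A' B' : qcat Q)
    (phi : qdist A B) (psi : qdist A' B')
    (F : qfunctor A A') (G : qfunctor B' B) :
  is_infomorphism phi psi F G ->
  exists (hphi : is_closure_space (isbell_closure phi))
         (hpsi : is_closure_space (isbell_closure psi)),
    @is_continuous Q (ClosureSpace hphi) (ClosureSpace hpsi) F.
Proof.
move=> FG; exists (isbell_closure_closure phi), (isbell_closure_closure psi).
exact: direct_image_isbell_closure FG.
Qed.
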